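(* Let $\mu$ be a Borel probability measure on $\mathbb{R}$ with $m_1(\mu)=0$, $m_2(\mu)=1$ and $\mathrm{supp}(\mu)\subset[-K,K]$ for some $K>0$. For $n\ge1$ let $\mu_n=D_{1/\sqrt{n}}\,\mu^{\uplus n}$. Then for every $n$ with $\sqrt{n}>K$: (1) $\mathrm{supp}(\mu_n)\subset[-\frac{K}{\sqrt n},\frac{K}{\sqrt n}]\cup\{x_1,x_2\}$ for some real $x_1,x_2$ with $|-1-x_1|\le \frac{K}{\sqrt n}$ and $|1-x_2|\le\frac{K}{\sqrt n}$; (2) with $p=\mu_n(\{x_1\})$, $q=\mu_n(\{x_2\})$ and $r=\mu_n([-\frac{K}{\sqrt n},\frac{K}{\sqrt n}])$, one has $p,q\in[\frac12-\frac{2K}{\sqrt n},\frac12+\frac{K}{2\sqrt n}]$ and $r<\frac{4K}{\sqrt n}$. In particular $L(\mu_n,\mathbf{b})\le \frac{2K}{\sqrt n}$.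
   Context: $m_k(\mu)=\int x^k d\mu$. For a Borel probability measure $\mu$ on $\mathbb{R}$ and $a>0$, $D_a\mu(B)=\mu(a^{-1}B)$. The Cauchy transform is $G_\mu(z)=\int_{\mathbb{R}}\frac{1}{z-t}\,d\mu(t)$ for $z\in\mathbb{C}^+$, $F_\mu=1/G_\mu$, $K_\mu(z)=z-F_\mu(z)$. The Boolean convolution $\mu\uplus\nu$ is the unique probability measure with $K_{\mu\uplus\nu}=K_\mu+K_\nu$ on $\mathbb{C}^+$; $\mu^{\uplus n}$ is the $n$-fold Boolean convolution power. $\mathbf{b}=\frac12\delta_{-1}+\frac12\delta_1$. The Lévy distance between probability measures with distribution functions $F,G$ is $L=\inf\{\epsilon>0: F(x-\epsilon)-\epsilon\le G(x)\le F(x+\epsilon)+\epsilon\ \forall x\in\mathbb{R}\}$. *)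

(* Defs.v *)
From HB Require Import structures.
From mathcomp Require Import all_boot all_order all_algebra all_classical all_reals all_analysis.
From mathcomp Require Import complex.
Set Implicit Arguments. Unset Strict Implicit. Unset Printing Implicit Defensive.
Import Order.TTheory GRing.Theory Num.Theory.
Import numFieldNormedType.Exports.
Local Open Scope classical_set_scope.
Local Open Scope ring_scope.

Section Defs.
Variable R : realType.

Definition moment (k : nat) (mu : measure R R) : \bar R :=
  (\int[mu]_x (x ^+ k)%:E)%E.

Definition msupport (mu : set R -> \bar R) : set R :=
  [set x : R | forall e : R, 0 < e -> (0 < mu (ball x e))%E].

Definition dilate (a : R) (mu : set R -> \bar R) : set R -> \bar R :=
  fun B => mu ((fun y => a * y) @^-1` B).

Definition cauchy_transform (mu : measure R R) (z : R[i]) : R[i] :=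
  (Rintegral mu setT (fun t => complex.Re ((z - t%:C)^-1)) +i*
   Rintegral mu setT (fun t => complex.Im ((z - t%:C)^-1)))%C.

Definition F_transform (mu : measure R R) (z : R[i]) : R[i] :=
  (cauchy_transform mu z)^-1.

Definition K_transform (mu : measure R R) (z : R[i]) : R[i] :=
  z - F_transform mu z.

(* nu is the n-fold Boolean convolution power of mu:
   K_nu = n K_mu on the upper half plane (this characterizes nu uniquely) *)
Definition is_boolean_power (mu : measure R R) (n : nat) (nu : measure R R) :=
  forall z : R[i], 0 < complex.Im z -> K_transform nu z = n%:R * K_transform mu z.

Definition distr_fun (mu : set R -> \bar R) (x : R) : R := fine (mu `]-oo, x]%classic).

Definition levy_dist (F G : R -> R) : R :=
  inf [set e : R | 0 < e /\
        forall x : R, F (x - e) - e <= G x /\ G x <= F (x + e) + e].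

Definition bern : set R -> \bar R :=
  fun B => ((1/2) * ((\1_B (-1) : R) + \1_B 1))%:E.

End Defs.

(* Main.v *)
Require Import Defs.
From HB Require Import structures.
From mathcomp Require Import all_boot all_order all_algebra all_classical all_reals all_analysis.
From mathcomp Require Import complex.
From mathcomp Require Import measurable_realfun ring lra.
Import Order.TTheory GRing.Theory Num.Theory.
Import numFieldNormedType.Exports.
Local Open Scope classical_set_scope.
Local Open Scope ring_scope.

(* Write G for the Cauchy transform of mu, N = n and nu for the n-fold Boolean
   power.  The defining relation solves to
     G_nu(z) = G(z) / (N - (N - 1) z G(z)),
   where off [-K, K] the right-hand side has real boundary values whose only
   singularities are the zeros X of N - (N - 1) x G(x); x G(x) is monotone on
   each side of [-K, K], so each side carries at most one.  Since
   nu [x - y, x + y] <= 2 y |Im G_nu(x + iy)| and Im G_nu = O(y) locally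
   uniformly away from the zeros, nu of an interval of length l is O(l^2), hence
   zero by repeated halving.  At a zero, nu {X} = lim - y Im G_nu(X + iy) equals
   G(X) / ((N - 1)(X S(X) - G(X))) with S(x) = \int (x - t)^-2 dmu.
   Location and mass of the zeros then follow from integrating pointwise
   nonnegative combinations of 1, t, t^2, 1/(x - t), 1/(x - t)^2, and the Levy
   bound follows from the location and the masses. *)

Set Implicit Arguments.
Unset Strict Implicit.
Unset Printing Implicit Defensive.


(** * Integration against a centered measure of unit variance on [-K, K] *)

Section ContinuousOnInterval.
Context {R : realType} (K : R).

(** Continuity in R at each point of the interval, not of the restriction to it; poles outside
    [-K, K] are allowed. *)
Definition cont_on (u : R -> R) :=
  forall t : R, - K <= t <= K -> {for t, continuous u}.

Lemma cont_on_cst c : cont_on (fun=> c).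
Proof. by move=> t _; exact: cst_continuous. Qed.

Lemma cont_on_id : cont_on id.
Proof. by move=> t _; exact: cvg_id. Qed.

Lemma cont_on_opp u : cont_on u -> cont_on (fun t => - u t).
Proof. by move=> cu t tK; apply: cvgN; exact: cu. Qed.

Lemma cont_on_add u v : cont_on u -> cont_on v -> cont_on (fun t => u t + v t).
Proof. by move=> cu cv t tK; apply: cvgD; [exact: cu|exact: cv]. Qed.

Lemma cont_on_mul u v : cont_on u -> cont_on v -> cont_on (fun t => u t * v t).
Proof. by move=> cu cv t tK; apply: cvgM; [exact: cu|exact: cv]. Qed.

Lemma cont_on_inv u : cont_on u -> (forall t, - K <= t <= K -> u t != 0) ->
  cont_on (fun t => (u t)^-1).
Proof. by move=> cu u0 t tK; apply: cvgV; [exact: u0|exact: cu]. Qed.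

Lemma cont_on_flip u : cont_on u -> cont_on (fun t => u (- t)).
Proof.
move=> cu t tK; apply: (@continuous_comp _ _ _ -%R u).
  exact: opp_continuous.
by apply: cu; lra.
Qed.

End ContinuousOnInterval.

(* The only property of [u |-> \int u dmu] used for the real-variable
   estimates; it is also satisfied by the reflected functional, which reduces
   the negative half-line to the positive one. *)
Definition standardized {R : realType} (K : R) (E : (R -> R) -> R) :=
  forall (a b c e f : R) (u v : R -> R), cont_on K u -> cont_on K v ->
    (forall t, - K <= t <= K ->
       0 <= a + b * t + c * t ^+ 2 + e * u t + f * v t) ->
    0 <= a + c + e * E u + f * E v.

(** When [E] integrates against mu and z = x + iy, [cauchy_re] is Re G(z) and [poisson] is - Im G(z)
    / y. At y = 0 and off [-K, K] these become [cauchy_real], which is G(x), and [cauchy_sq], which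
    is - G'(x). *)
Definition cauchy_re {R : realType} (E : (R -> R) -> R) (x y : R) :=
  E (fun t => (x - t) / ((x - t) ^+ 2 + y ^+ 2)).
Definition poisson {R : realType} (E : (R -> R) -> R) (x y : R) :=
  E (fun t => ((x - t) ^+ 2 + y ^+ 2)^-1).
Definition cauchy_real {R : realType} (E : (R -> R) -> R) (x : R) :=
  E (fun t => (x - t)^-1).
Definition cauchy_sq {R : realType} (E : (R -> R) -> R) (x : R) :=
  E (fun t => (x - t)^-2).

Section Standardized.
Context {R : realType} {K : R} {E : (R -> R) -> R}.
Hypothesis HE : standardized K E.
Local Notation g := (cauchy_re E).
Local Notation s := (poisson E).
Local Notation G := (cauchy_real E).
Local Notation S := (cauchy_sq E).

Lemma standardized_flip : standardized K (fun u => E (fun t => u (- t))).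
Proof.
move=> a b c e f u v cu cv H.
apply: (@HE a (- b) c e f); [exact: cont_on_flip|exact: cont_on_flip|].
move=> t tK; have := H (- t); rewrite sqrrN mulrN mulNr; apply; lra.
Qed.

Lemma standardized_ge0 a b c e u : cont_on K u ->
  (forall t, - K <= t <= K -> 0 <= a + b * t + c * t ^+ 2 + e * u t) ->
  0 <= a + c + e * E u.
Proof.
move=> cu H; rewrite -[X in 0 <= X]addr0 -[X in _ + X](mul0r (E u)).
by apply: (@HE a b c e 0) => // t tK; rewrite mul0r addr0 H.
Qed.

Lemma standardized_dist C u v : cont_on K u -> cont_on K v ->
  (forall t, - K <= t <= K -> `|u t - v t| <= C) -> `|E u - E v| <= C.
Proof.
move=> cu cv H; rewrite ler_norml; apply/andP; split; rewrite -subr_ge0.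
  have := @HE C 0 0 1 (-1) u v cu cv.
  suff -> : E u - E v - - C = C + 0 + 1 * E u + -1 * E v.
    apply=> t tK; have := H t tK; rewrite ler_norml; lra.
  ring.
have := @HE C 0 0 (-1) 1 u v cu cv.
suff -> : C - (E u - E v) = C + 0 + -1 * E u + 1 * E v.
  apply=> t tK; have := H t tK; rewrite ler_norml; lra.
ring.
Qed.

Lemma standardized_ext u v : cont_on K u -> cont_on K v ->
  (forall t, - K <= t <= K -> u t = v t) -> E u = E v.
Proof.
move=> cu cv H; apply/eqP; rewrite -subr_eq0 -normr_le0.
by apply: standardized_dist => // t tK; rewrite H// subrr normr0.
Qed.

Lemma standardized_norm C u : cont_on K u ->
  (forall t, - K <= t <= K -> `|u t| <= C) -> `|E u| <= C.
Proof.
move=> cu H; have := @standardized_ge0 C 0 0 1 u cu.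
have := @standardized_ge0 C 0 0 (-1) u cu.
move=> H1 H2; rewrite ler_norml; apply/andP; split.
  suff : 0 <= C + 0 + 1 * E u by lra.
  by apply: H2 => t tK; have := H t tK; rewrite ler_norml; lra.
suff : 0 <= C + 0 + (-1) * E u by lra.
by apply: H1 => t tK; have := H t tK; rewrite ler_norml; lra.
Qed.

(** The integral of K^2 - t^2 >= 0 is K^2 - 1. *)
Lemma bound_ge1 : 0 < K -> 1 <= K.
Proof.
move=> K0; have := @standardized_ge0 (K ^+ 2) 0 (-1) 0 _ (@cont_on_cst R K 0).
suff H : forall t : R, - K <= t <= K -> 0 <= K ^+ 2 + 0 * t + -1 * t ^+ 2 + 0 * 0.
  move=> /(_ H); nra.
move=> t tK; nra.
Qed.

Lemma cont_on_sub x : cont_on K (fun t => x - t).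
Proof.
by apply: cont_on_add; [exact: cont_on_cst|apply: cont_on_opp; exact: cont_on_id].
Qed.

Lemma cont_on_subV x : (forall t, - K <= t <= K -> x - t != 0) ->
  cont_on K (fun t => (x - t)^-1).
Proof. by move=> xt; apply: cont_on_inv => //; exact: cont_on_sub. Qed.

Lemma cont_on_subX2 x y : cont_on K (fun t => (x - t) ^+ 2 + y ^+ 2).
Proof.
apply: cont_on_add; last exact: cont_on_cst.
by apply: cont_on_mul; exact: cont_on_sub.
Qed.

Lemma cont_on_subV2 x : (forall t, - K <= t <= K -> x - t != 0) ->
  cont_on K (fun t => (x - t)^-2).
Proof.
move=> xt; apply: cont_on_inv; last by move=> t tK; rewrite expf_neq0// xt.
by apply: cont_on_mul; exact: cont_on_sub.
Qed.

(** Quantifies that x lies off [-K, K]: the kernel bounds involve only r, hence are uniform near a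
    point. *)
Definition far (r x : R) := forall t, - K <= t <= K -> r <= `|x - t|.

Lemma far_neq0 r x : 0 < r -> far r x -> forall t, - K <= t <= K -> x - t != 0.
Proof. by move=> r0 rx t tK; rewrite -normr_gt0 (lt_le_trans r0)// rx. Qed.

Lemma far_sq r x y t : 0 < r -> far r x -> - K <= t <= K ->
  r ^+ 2 <= (x - t) ^+ 2 + y ^+ 2.
Proof.
move=> r0 rx tK; rewrite -[r ^+ 2]addr0 lerD ?sqr_ge0//.
by rewrite -[(x - t) ^+ 2]real_normK ?num_real// ler_sqr ?nnegrE ?rx// ltW.
Qed.

Lemma far_sq_neq0 r x y : 0 < r -> far r x ->
  forall t, - K <= t <= K -> (x - t) ^+ 2 + y ^+ 2 != 0.
Proof.
move=> r0 rx t tK; apply: lt0r_neq0; apply: lt_le_trans (far_sq y r0 rx tK).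
by rewrite exprn_gt0.
Qed.

Lemma cont_on_poisson x y : (forall t, - K <= t <= K -> (x - t) ^+ 2 + y ^+ 2 != 0) ->
  cont_on K (fun t => ((x - t) ^+ 2 + y ^+ 2)^-1).
Proof. by move=> xt; apply: cont_on_inv => //; exact: cont_on_subX2. Qed.

Lemma cont_on_cauchy_re x y :
  (forall t, - K <= t <= K -> (x - t) ^+ 2 + y ^+ 2 != 0) ->
  cont_on K (fun t => (x - t) / ((x - t) ^+ 2 + y ^+ 2)).
Proof.
by move=> xt; apply: cont_on_mul; [exact: cont_on_sub|exact: cont_on_poisson].
Qed.

Lemma poisson_gt0 x y : 0 < y -> 0 < s x y.
Proof.
move=> y0.
have xt t : 0 < (x - t) ^+ 2 + y ^+ 2 by rewrite ltr_wpDl ?sqr_ge0 ?exprn_gt0.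
(* [C] dominates the denominator, since (x - t)^2 <= 2 x^2 + 2 t^2. Only weak inequalities can be
   integrated, so strictness comes from the constant lower bound 1 / [C]. *)
pose C := 2 * x ^+ 2 + 2 * K ^+ 2 + y ^+ 2.
have C0 : 0 < C by rewrite /C; have := exprn_gt0 2 y0; nra.
have := @standardized_ge0 (- C^-1) 0 0 1 _ (cont_on_poisson (fun t _ => lt0r_neq0 (xt t))).
move=> H; suff : 0 <= - C^-1 + 0 + 1 * s x y by have := invr_gt0 C; rewrite C0; lra.
apply: H => t tK; rewrite !mul0r !addr0 mul1r addrC subr_ge0 lef_pV2 ?posrE// /C.
have tK2 : t ^+ 2 <= K ^+ 2 by case/andP: tK => *; nra.
by have := sqr_ge0 (x + t); nra.
Qed.

Lemma poisson_le r x y : 0 < r -> far r x -> `|s x y| <= r^-2.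
Proof.
move=> r0 rx; apply: standardized_norm.
  by apply: cont_on_poisson => t tK; exact: (far_sq_neq0 _ r0 rx tK).
move=> t tK; have H := far_sq y r0 rx tK.
have r20 : 0 < r ^+ 2 by rewrite exprn_gt0.
have q0 : 0 < (x - t) ^+ 2 + y ^+ 2 by exact: lt_le_trans H.
by rewrite ger0_norm ?invr_ge0 ?(ltW q0)// lef_pV2 ?posrE.
Qed.

Lemma cauchy_re0 r x : 0 < r -> far r x -> g x 0 = G x.
Proof.
move=> r0 rx; apply: standardized_ext.
- by apply: cont_on_cauchy_re => t tK; exact: (far_sq_neq0 _ r0 rx tK).
- by apply: cont_on_subV => t tK; exact: (far_neq0 r0 _ tK).
- move=> t tK; have := far_neq0 r0 rx tK => xt.
  by field.
Qed.

Lemma cauchy_re_dist r x x0 y : 0 < r -> far r x -> far r x0 ->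
  `|g x y - G x0| <= (r^-2 + r^-3) * (`|x - x0| + y ^+ 2).
Proof.
move=> r0 rx rx0; apply: standardized_dist.
- by apply: cont_on_cauchy_re => t tK; exact: (far_sq_neq0 _ r0 rx tK).
- by apply: cont_on_subV => t tK; exact: (far_neq0 r0 _ tK).
move=> t tK.
have Q := far_sq y r0 rx tK.
have Q0 := far_sq_neq0 y r0 rx tK.
have b0 := far_neq0 r0 rx0 tK.
have rb := rx0 t tK.
set a := x - t in Q Q0 *; set b := x0 - t in b0 rb *.
(* The first term carries the displacement x - x0, the second the height y. *)
have -> : a / (a ^+ 2 + y ^+ 2) - b^-1 =
   (a / (a ^+ 2 + y ^+ 2)) * (- (x - x0) / b) - y ^+ 2 / (b * (a ^+ 2 + y ^+ 2)).
  have -> : x - x0 = a - b by rewrite /a /b; ring.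
  by field; rewrite b0 Q0.
have bV : `|b^-1| <= r^-1 by rewrite normrV ?unitfE// lef_pV2 ?posrE ?normr_gt0.
have QV : `|(a ^+ 2 + y ^+ 2)^-1| <= r^-2.
  rewrite normrV ?unitfE// lef_pV2 ?posrE ?normr_gt0 ?exprn_gt0//.
  by rewrite (le_trans Q)// ler_norm.
have aV : `|a / (a ^+ 2 + y ^+ 2)| <= r^-1.
  have ra : r <= `|a| by exact: rx.
  have a0 : 0 < `|a| by exact: lt_le_trans ra.
  apply: (@le_trans _ _ `|a|^-1); last by rewrite lef_pV2 ?posrE.
  rewrite normrM normrV ?unitfE// ler_pdivrMr ?normr_gt0//.
  rewrite mulrC ler_pdivlMr// -expr2 real_normK ?num_real//.
  by rewrite ger0_norm ?addr_ge0 ?sqr_ge0// lerDl sqr_ge0.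
apply: (le_trans (ler_normB _ _)).
have -> : `|a / (a ^+ 2 + y ^+ 2) * (- (x - x0) / b)| =
    `|a / (a ^+ 2 + y ^+ 2)| * (`|x - x0| * `|b^-1|).
  by rewrite normrM [`|- _ / _|]normrM normrN.
have -> : `|y ^+ 2 / (b * (a ^+ 2 + y ^+ 2))| =
    y ^+ 2 * (`|b^-1| * `|(a ^+ 2 + y ^+ 2)^-1|).
  by rewrite normrM invfM [`|b^-1 * _|]normrM ger0_norm ?sqr_ge0.
have rV0 : 0 <= r^-1 by rewrite invr_ge0 ltW.
have -> : r^-3 = r^-1 * r^-2 by rewrite -invfM -exprS.
have rV20 : 0 <= r^-2 by rewrite invr_ge0 exprn_ge0 // ltW.
have H1 : `|a / (a ^+ 2 + y ^+ 2)| * (`|x - x0| * `|b^-1|) <= r^-2 * `|x - x0|.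
  rewrite mulrCA mulrC ler_wpM2r//.
  have -> : r^-2 = r^-1 * r^-1 by rewrite -invfM -expr2.
  by rewrite ler_pM.
have H2 : y ^+ 2 * (`|b^-1| * `|(a ^+ 2 + y ^+ 2)^-1|) <= (r^-1 * r^-2) * y ^+ 2.
  by rewrite mulrC ler_wpM2r ?sqr_ge0// ler_pM.
apply: (le_trans (lerD H1 H2)).
rewrite mulrDl !mulrDr.
have := mulr_ge0 rV20 (normr_ge0 (x - x0)).
have := mulr_ge0 rV20 (sqr_ge0 y).
have := mulr_ge0 (mulr_ge0 rV0 rV20) (normr_ge0 (x - x0)).
lra.
Qed.

Lemma poisson_dist r x y : 0 < r -> far r x -> `|s x y - S x| <= r^-4 * y ^+ 2.
Proof.
move=> r0 rx; apply: standardized_dist.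
- by apply: cont_on_poisson => t tK; exact: (far_sq_neq0 _ r0 rx tK).
- by apply: cont_on_subV2 => t tK; exact: (far_neq0 r0 _ tK).
move=> t tK.
have Q := far_sq y r0 rx tK.
have Q2 := far_sq 0 r0 rx tK.
have Q0 := far_sq_neq0 y r0 rx tK.
have b0 := far_neq0 r0 rx tK.
have -> : ((x - t) ^+ 2 + y ^+ 2)^-1 - (x - t)^-2 =
  - (((x - t) ^+ 2 + y ^+ 2)^-1 * (x - t)^-2 * y ^+ 2).
  by field; rewrite b0 Q0.
have r20 : 0 < r ^+ 2 by rewrite exprn_gt0.
rewrite expr0n addr0 in Q2.
rewrite normrN ger0_norm; last first.
  have Q1 : 0 <= (x - t) ^+ 2 + y ^+ 2 by rewrite addr_ge0 ?sqr_ge0.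
  by rewrite mulr_ge0 ?sqr_ge0// mulr_ge0 ?invr_ge0 ?sqr_ge0.
rewrite ler_wpM2r ?sqr_ge0//.
have -> : r^-4 = r^-2 * r^-2 by rewrite -invfM -exprD.
have Q1 : 0 <= (x - t) ^+ 2 + y ^+ 2 by rewrite addr_ge0 ?sqr_ge0.
apply: ler_pM; rewrite ?invr_ge0 ?sqr_ge0//.
  by rewrite lef_pV2 ?posrE// (lt_le_trans r20).
by rewrite lef_pV2 ?posrE// (lt_le_trans r20).
Qed.

Lemma far_near x0 x : K < `|x0| -> `|x - x0| <= (`|x0| - K) / 2 ->
  far ((`|x0| - K) / 2) x.
Proof.
move=> Kx0 xx0 t /andP[Kt tK].
have tn : `|t| <= K by rewrite ler_norml Kt.
have := ler_distD x x0 t; have := lerB_dist x0 t.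
rewrite (distrC x0 x); lra.
Qed.

End Standardized.

(** * Zeros on the positive half-line *)

Section RealZeros.
Context {R : realType} {K : R} {E : (R -> R) -> R}.
Hypotheses (K0 : 0 < K) (HE : standardized K E).
Local Notation G := (cauchy_real E).
Local Notation S := (cauchy_sq E).

Lemma sub_gt0 x : K < x -> forall t, - K <= t <= K -> 0 < x - t.
Proof. by move=> Kx t tK; lra. Qed.

Lemma cont_on_inv_right x : K < x -> cont_on K (fun t => (x - t)^-1).
Proof. by move=> Kx; apply: cont_on_subV => t tK; rewrite gt_eqF// sub_gt0. Qed.

(** Integrate x^2 / (x - t) = x + t + t^2 / (x - t) and bound the last term by t^2 / (x - K); the
    next lemma bounds it below by t^2 / (x + K). *)
Lemma cauchy_real_upper x : K < x -> x ^+ 2 * G x - x <= (x - K)^-1.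
Proof.
move=> Kx.
have H := @standardized_ge0 _ _ _ HE x 1 (x - K)^-1 (- x ^+ 2) _ (cont_on_inv_right Kx).
suff : 0 <= x + (x - K)^-1 + - x ^+ 2 * G x by lra.
apply: H => t tK.
have xt := sub_gt0 Kx tK.
have xK : 0 < x - K by lra.
have -> : x + 1 * t + (x - K)^-1 * t ^+ 2 + - x ^+ 2 * (x - t)^-1 =
   t ^+ 2 * ((K - t) / ((x - K) * (x - t))).
  by field; rewrite !gt_eqF.
by rewrite mulr_ge0 ?sqr_ge0// divr_ge0 ?mulr_ge0//; lra.
Qed.

Lemma cauchy_real_lower x : K < x -> (x + K)^-1 <= x ^+ 2 * G x - x.
Proof.
move=> Kx.
have H := @standardized_ge0 _ _ _ HE (- x) (-1) (- (x + K)^-1) (x ^+ 2) _ (cont_on_inv_right Kx).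
suff : 0 <= - x + - (x + K)^-1 + x ^+ 2 * G x by lra.
apply: H => t tK.
have xt := sub_gt0 Kx tK.
have xK : 0 < x + K by lra.
have -> : - x + -1 * t + - (x + K)^-1 * t ^+ 2 + x ^+ 2 * (x - t)^-1 =
   t ^+ 2 * ((K + t) / ((x + K) * (x - t))).
  by field; rewrite !gt_eqF.
by rewrite mulr_ge0 ?sqr_ge0// divr_ge0 ?mulr_ge0//; lra.
Qed.

(** The integrated function (K t - 1)^2 (K + t) / (x - t) vanishes at -K and 1 / K, the atoms of a
    centered two-point law of unit variance, for which the bound is an equality. *)
Lemma cauchy_real_lower_sharp x : K < x ->
  (K * x - 1) * (K * x - 1 + K ^+ 2) <= (K + x) * (K * x - 1) ^+ 2 * G x.
Proof.
move=> Kx.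
have H := @standardized_ge0 _ _ _ HE
  (- (K ^+ 2 * x ^+ 2 + (K ^+ 3 - 2 * K) * x + 1 - 2 * K ^+ 2))
  (- (K ^+ 2 * x + K ^+ 3 - 2 * K)) (- K ^+ 2) ((K + x) * (K * x - 1) ^+ 2)
  _ (cont_on_inv_right Kx).
suff : 0 <= - (K ^+ 2 * x ^+ 2 + (K ^+ 3 - 2 * K) * x + 1 - 2 * K ^+ 2) +
   - K ^+ 2 + (K + x) * (K * x - 1) ^+ 2 * G x by lra.
apply: H => t tK.
have xt := sub_gt0 Kx tK.
rewrite [X in 0 <= X](_ : _ = (K * t - 1) ^+ 2 * ((K + t) / (x - t))); last first.
  by field; rewrite gt_eqF.
by rewrite mulr_ge0 ?sqr_ge0// divr_ge0//; lra.
Qed.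

(* Bessel's inequality for 1/(x - t) and the orthonormal pair 1, t *)
Lemma cauchy_sq_lower x : K < x -> G x ^+ 2 + (x * G x - 1) ^+ 2 <= S x.
Proof.
move=> Kx.
set y := G x.
have H := @HE (y ^+ 2 + 2 * (x * y - 1)) (2 * y * (x * y - 1)) ((x * y - 1) ^+ 2)
   (- 2 * y - 2 * (x * y - 1) * x) 1 _ _ (cont_on_inv_right Kx)
   (cont_on_subV2 (fun t tK => lt0r_neq0 (sub_gt0 Kx tK))).
suff : 0 <= y ^+ 2 + 2 * (x * y - 1) + (x * y - 1) ^+ 2 +
   (- 2 * y - 2 * (x * y - 1) * x) * y + 1 * S x by nra.
apply: H => t tK.
have xt := sub_gt0 Kx tK.
rewrite [X in 0 <= X](_ : _ = ((x - t)^-1 - y - (x * y - 1) * t) ^+ 2) ?sqr_ge0//.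
by field; rewrite gt_eqF.
Qed.

(** Integrate t^2 / (x - t)^2 <= t^2 / ((x - K) (x - t)), expanding both sides with t = x - (x -
    t). *)
Lemma cauchy_sq_upper x : K < x ->
  x ^+ 2 * S x <= (x ^+ 2 * G x - x) / (x - K) + 2 * x * G x - 1.
Proof.
move=> Kx.
have H := @HE (- x / (x - K) - 1) (- (x - K)^-1) 0
   (x ^+ 2 / (x - K) + 2 * x) (- x ^+ 2) _ _ (cont_on_inv_right Kx)
   (cont_on_subV2 (fun t tK => lt0r_neq0 (sub_gt0 Kx tK))).
suff : 0 <= - x / (x - K) - 1 + 0 + (x ^+ 2 / (x - K) + 2 * x) * G x + - x ^+ 2 * S x.
  by lra.
apply: H => t tK.
have xt := sub_gt0 Kx tK.
have xK : 0 < x - K by lra.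
rewrite [X in 0 <= X](_ : _ = t ^+ 2 * ((K - t) / ((x - K) * (x - t) ^+ 2))); last first.
  by field; rewrite !gt_eqF.
rewrite mulr_ge0 ?sqr_ge0// divr_ge0//; first by lra.
by rewrite mulr_ge0 ?sqr_ge0// ltW.
Qed.

(** The difference x / (x - t) - x' / (x' - t) changes sign at t = 0. Subtracting its linear part
    there, which has mean zero, leaves at least [k] t^2, and the mean [k] > 0 of that bound gives
    strictness. *)
Lemma mul_cauchy_real_decr x x' : K < x -> x < x' -> x' * G x' < x * G x.
Proof.
move=> Kx xx'; have Kx' : K < x' by lra.
have K_gt0 := K0; have x0 : 0 < x by lra.
have x'0 : 0 < x' by lra.
have xK : 0 < x + K by lra.
pose k := (x' - x) / (x * x' * (x + K)).
have k0 : 0 < k by rewrite divr_gt0 ?mulr_gt0//; lra.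
have H := @HE 0 (- (x^-1 - x'^-1)) (- k) x (- x') _ _
   (cont_on_inv_right Kx) (cont_on_inv_right Kx').
suff : 0 <= 0 + - k + x * G x + - x' * G x' by lra.
apply: H => t tK.
have xt := sub_gt0 Kx tK; have xt' := sub_gt0 Kx' tK.
rewrite [X in 0 <= X](_ : _ = (x' - x) / (x * x') * t ^+ 2 *
   ((x + K)^-1 * ((K + t) * (x' - t) + x * (x + K)) / ((x - t) * (x' - t)))); last first.
  by rewrite /k; field; rewrite !gt_eqF.
apply: mulr_ge0; first by rewrite mulr_ge0 ?sqr_ge0// divr_ge0 ?mulr_ge0//; lra.
apply: divr_ge0; last by rewrite mulr_ge0//; lra.
by rewrite mulr_ge0 ?invr_ge0 ?addr_ge0 ?mulr_ge0//; lra.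
Qed.

Lemma continuous_cauchy_real x : K < x -> {for x, continuous G}.
Proof.
have K_gt0 := K0; move=> Kx; have xn : `|x| = x by rewrite ger0_norm//; lra.
have Kxn : K < `|x| by rewrite xn.
set r := (`|x| - K) / 2.
have r0 : 0 < r by rewrite /r; lra.
have C0 : 0 < r^-2 + r^-3 by rewrite addr_gt0 ?invr_gt0 ?exprn_gt0.
apply/cvgrPdist_lt => e e0; near=> z.
have zx : `|z - x| <= r.
  rewrite distrC ltW//; near: z; exact: (@nbhsx_ballx _ R^o x r r0).
have fz : @far R K r z by exact: far_near.
have fx : @far R K r x by apply: far_near => //; rewrite subrr normr0 ltW.
rewrite distrC -(cauchy_re0 HE r0 fz).
apply: le_lt_trans (cauchy_re_dist HE 0 r0 fz fx) _.
rewrite expr0n addr0 mulrC -ltr_pdivlMr// distrC.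
by near: z; apply: (@nbhsx_ballx _ R^o x); rewrite divr_gt0.
Unshelve. all: by end_near. Qed.

(** * Location and mass of a single zero *)

Section Zero.
Variables (N X : R).
Hypotheses (N1 : 1 < N) (KX : K < X) (Xzero : (N - 1) * X * G X = N).

Let X0 : 0 < X. Proof. exact: lt_trans KX. Qed.
Let K1 : 1 <= K. Proof. exact: bound_ge1 HE K0. Qed.

(** At a zero, X^2 G(X) - X = X / (N - 1), to which [cauchy_real_upper] applies. *)
Lemma zero_upper : X * (X - K) <= N - 1.
Proof.
have := cauchy_real_upper KX; have N_gt1 := N1; have K_lt_X := KX.
have Xz := Xzero; set y := G X in Xz *.
have XK : 0 < X - K by lra.
have H1 : (X ^+ 2 * y - X) * (N - 1) = X.
  by have -> : (X ^+ 2 * y - X) * (N - 1) = X * ((N - 1) * X * y) - X * (N - 1);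
    [ring|rewrite Xz; ring].
rewrite -[_^-1]mul1r ler_pdivlMr// => H.
rewrite -{1}H1 mulrAC -[leRHS]mul1r ler_wpM2r//; lra.
Qed.

(** The sharp lower bound on G yields N here, where [cauchy_real_lower] would yield N - 1; the
    estimate of the mass from above uses N. *)
Lemma zero_lower : N <= X * (X + K).
Proof.
have := cauchy_real_lower_sharp KX.
have N_gt1 := N1; have X_gt0 := X0; have K_ge1 := K1; have K_lt_X := KX.
have Xz := Xzero; set y := G X in Xz *.
have p : 0 < K * X - 1 by nra.
rewrite expr2 [_ * (_ * _)]mulrCA -mulrA ler_pM2l// => H.
have N0 : 0 < (N - 1) * X by rewrite mulr_gt0//; lra.
have := ler_wpM2l (ltW N0) H.
rewrite (_ : _ * ((K + X) * _ * y) = (K + X) * (K * X - 1) * ((N - 1) * X * y)); last by ring.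
rewrite Xz => H2.
suff : K * N <= K * (X * (X + K)) by rewrite ler_pM2l.
have -> : K * (X * (X + K)) = K * N + X +
  ((K + X) * (K * X - 1) * N - (N - 1) * X * (K * X - 1 + K ^+ 2)) by ring.
by rewrite -addrA lerDl addr_ge0 ?subr_ge0// ltW.
Qed.

Lemma zero_cauchy : G X = N / ((N - 1) * X).
Proof.
have N_gt1 := N1; have X_gt0 := X0.
by rewrite -{1}Xzero; field; rewrite !gt_eqF//; lra.
Qed.

(** The right-hand side is minus the derivative of x G(x) at X. Bessel's inequality is evaluated
    with X G(X) - 1 = 1 / (N - 1). *)
Lemma zero_slope_lower : (N + X ^+ 2) / ((N - 1) ^+ 2 * X) <= X * S X - G X.
Proof.
have := cauchy_sq_lower KX; rewrite zero_cauchy => H.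
have N_gt1 := N1; have X_gt0 := X0.
have := ler_wpM2l (ltW X0) H; rewrite -(lerD2r (- (N / ((N - 1) * X)))).
apply: le_trans; rewrite le_eqVlt; apply/orP; left; apply/eqP.
by field; rewrite !gt_eqF//; lra.
Qed.

Lemma zero_slope_upper :
  X * S X - G X <= (X / (X - K) + 1) / ((N - 1) * X).
Proof.
have := cauchy_sq_upper KX; rewrite zero_cauchy => H.
have N_gt1 := N1; have X_gt0 := X0; have K_lt_X := KX.
rewrite -(ler_pM2l X0) mulrBr mulrA -expr2.
rewrite lerBlDr; apply: le_trans H _.
rewrite le_eqVlt; apply/orP; left; apply/eqP.
by field; rewrite !gt_eqF//; lra.
Qed.

Lemma zero_slope_gt0 : 0 < X * S X - G X.
Proof.
have N_gt1 := N1; have X_gt0 := X0.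
apply: lt_le_trans zero_slope_lower.
by rewrite divr_gt0 ?addr_gt0 ?mulr_gt0 ?exprn_gt0//; lra.
Qed.

(** The residue of G(z) / (N - (N - 1) z G(z)) at z = X. *)
Definition zero_mass := G X / ((N - 1) * (X * S X - G X)).

Lemma zero_mass_upper : zero_mass <= N / (N + X ^+ 2).
Proof.
have N_gt1 := N1; have X_gt0 := X0; have B0 := zero_slope_gt0.
have X2 : 0 < X ^+ 2 by rewrite exprn_gt0.
have N10 : 0 < N - 1 by lra.
rewrite /zero_mass ler_pdivrMr; last by rewrite mulr_gt0.
have := zero_slope_lower; set z := X * S X - G X => Hz.
rewrite zero_cauchy.
rewrite (_ : N / ((N - 1) * X) =
  N / (N + X ^+ 2) * ((N - 1) * ((N + X ^+ 2) / ((N - 1) ^+ 2 * X)))); last first.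
  by field; rewrite !gt_eqF//; lra.
rewrite ler_pM2l ?divr_gt0//; [|lra|lra].
by rewrite ler_pM2l.
Qed.

Lemma zero_mass_lower : (X - K) / (2 * X - K) <= zero_mass.
Proof.
have N_gt1 := N1; have X_gt0 := X0; have B0 := zero_slope_gt0; have K_lt_X := KX.
have N10 : 0 < N - 1 by lra.
have p : 0 < 2 * X - K by lra.
have q : 0 < X - K by lra.
rewrite /zero_mass ler_pdivlMr; last by rewrite mulr_gt0.
have := zero_slope_upper; set z := X * S X - G X => H.
rewrite zero_cauchy; apply: (@le_trans _ _ ((X - K) / (2 * X - K) *
   ((N - 1) * ((X / (X - K) + 1) / ((N - 1) * X))))).
  by rewrite ler_pM2l ?divr_gt0// ler_pM2l.
(* The bound collapses to 1 / X, which is at most G(X) = N / ((N - 1) X). *)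
rewrite (_ : _ * _ = X^-1); last by field; rewrite !gt_eqF.
rewrite invfM mulrA ler_peMl ?invr_ge0 ?(ltW X0)// ler_pdivlMr//; lra.
Qed.

End Zero.

(** Intermediate values on [r - K, r + K], which lies to the right of K because 2 K < r. At the ends
    the lower and the upper bound on x^2 G(x) - x both equal 1 / r, and r (r - K) <= N - 1 <= r (r +
    K) as K r >= 1. *)
Lemma zero_exists (N r : R) : 0 <= r -> r ^+ 2 = N -> 2 * K < r ->
  exists2 X, K < X & (N - 1) * X * G X = N.
Proof.
move=> r0 rN Kr; have K_gt0 := K0; have K1 := bound_ge1 HE K0.
have N1 : 0 < N - 1 by rewrite -rN; nra.
pose f x := (N - 1) * x * G x.
have cf : {within `[r - K, r + K], continuous f}.
  apply: continuous_in_subspaceT => x; rewrite inE/= in_itv/= => /andP[x1 x2].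
  have Kx : K < x by lra.
  apply: cvgM; last exact: continuous_cauchy_real.
  by apply: cvgM; [exact: cvg_cst|exact: cvg_id].
have Hl : N <= f (r - K).
  have Kx : K < r - K by lra.
  have := cauchy_real_lower Kx; rewrite subrK.
  rewrite /f; set x := r - K in Kx *; set y := G x => H.
  have x0 : 0 < x by lra.
  have H1 : x <= (N - 1) / r by rewrite ler_pdivlMr; [rewrite /x -rN; nra|lra].
  have H2 : (N - 1) / r <= (N - 1) * (x ^+ 2 * y - x) by rewrite ler_pM2l.
  rewrite -(ler_pM2l x0).
  have -> : x * ((N - 1) * x * y) = (N - 1) * (x ^+ 2 * y - x) + (N - 1) * x by ring.
  lra.
have Hu : f (r + K) <= N.
  have Kx : K < r + K by lra.
  have := cauchy_real_upper Kx; rewrite addrK.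
  rewrite /f; set x := r + K in Kx *; set y := G x => H.
  have x0 : 0 < x by lra.
  have H1 : (N - 1) / r <= x by rewrite ler_pdivrMr; [rewrite /x -rN; nra|lra].
  have H2 : (N - 1) * (x ^+ 2 * y - x) <= (N - 1) / r by rewrite ler_pM2l.
  rewrite -(ler_pM2l x0).
  have -> : x * ((N - 1) * x * y) = (N - 1) * (x ^+ 2 * y - x) + (N - 1) * x by ring.
  lra.
have ab : r - K <= r + K by lra.
have [|X] := IVT ab cf (v := N).
  by rewrite ge_min le_max Hl Hu orbT.
rewrite in_itv/= => /andP[X1 X2] fX; exists X => //; lra.
Qed.

End RealZeros.

(** * Integrals, Cauchy transforms and null sets *)

(** U is covered by countably many null balls of rational center and radius. In the enumeration,
    codes of nothing and of non-null balls are sent to the empty set. *)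
Lemma locally_null {R : realType} (nu : {measure set R -> \bar R}) (U : set R) :
  measurable U -> (forall x, U x -> exists2 e : R, 0 < e & nu (ball x e) = 0%E) ->
  nu U = 0%E.
Proof.
move=> mU H.
pose F (i : nat) : set R :=
  if unpickle i is Some (c, r) then
    let B := ball (@ratr R c) (ratr r) in if nu B == 0%E then B else set0
  else set0.
have : nu.-negligible (\bigcup_i F i).
  apply: negligible_bigcup => i; rewrite /F.
  case: (unpickle i) => [[c r]|]; last exact: negligible_set0.
  case: eqP => [B0|_]; last exact: negligible_set0.
  by exists (ball (@ratr R c) (ratr r)); split => //; by exact: measurable_ball.
move=> negF; apply/negligibleP => //; apply: negligibleS negF => x /H[e e0 xe].
have oB : open (ball x e) by exact: ball_open.
have [|c [r [/set_mem xB Bxe]]] := @open_subball_rat R (ball x e) x oB.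
  by rewrite inE; exact: ballxx.
have FB : F (pickle (c, r)) = ball (@ratr R c) (ratr r).
  rewrite /F pickleK /= ifT//; apply/eqP/(@subset_measure0 _ _ _ nu _ (ball x e)) => //.
  by exact: measurable_ball.
  by exact: measurable_ball.
by exists (pickle (c, r)); [exact: I|rewrite FB].
Qed.

Section Integral.
Context {R : realType} (mu : probability R R) (K : R).
Hypothesis muK : mu (~` `[- K, K]%classic) = 0%E.
Local Notation I := (`[- K, K]%classic : set R).

(** Restricting to [-K, K], whose complement is null, makes kernels with poles outside it bounded
    and hence integrable. *)
Definition integral_on (u : R -> R) : R := \int[mu]_(t in I) u t.

Lemma cont_on_integrable u : cont_on K u -> mu.-integrable I (EFin \o u).
Proof.
move=> cu.
have cI : {within I, continuous u}.
  by apply: continuous_in_subspaceT => x; rewrite inE/= in_itv/= => /cu.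
apply: measurable_bounded_integrable => //.
- by rewrite (le_lt_trans (probability_le1 _ _)) ?ltry//.
- by apply: subspace_continuous_measurable_fun => //.
- have /compact_bounded[M [_ mrt]] := continuous_compact cI (@segment_compact R (- K) K).
  by exists M; split; rewrite ?num_real // => ? ? ? ?; exact: mrt.
Qed.

Lemma continuous_integrable (u : R -> R) : continuous u ->
  mu.-integrable setT (EFin \o u).
Proof.
move=> cu; apply/(negligible_integrable (N := ~` I)) => //.
- exact: measurableC.
- by apply/measurable_EFinP; exact: continuous_measurable_fun.
- by rewrite setTD setCK; apply: cont_on_integrable => t _; exact: cu.
Qed.

Lemma integral_setT_on (u : R -> R) : continuous u ->
  (\int[mu]_t (u t)%:E = \int[mu]_(t in I) (u t)%:E)%E.
Proof.
move=> cu; rewrite (@negligible_integral _ _ _ mu setT (~` I))//.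
- by rewrite setTD setCK.
- exact: measurableC.
- exact: continuous_integrable.
Qed.

Lemma Rintegral_setT_on (u : R -> R) : continuous u ->
  \int[mu]_t u t = integral_on u.
Proof. by move=> cu; rewrite /Rintegral integral_setT_on. Qed.

Hypotheses (m1 : moment 1 mu = 0%E) (m2 : moment 2 mu = 1%E).

Lemma integral_standardized : standardized K integral_on.
Proof.
move=> a b c e f u v cu cv H.
have cX n : continuous (fun t : R => t ^+ n) by exact: exprn_continuous.
have i1 : integral_on (fun=> 1) = 1.
  have muI : mu I = 1%E.
    have := probability_setC mu (A := I) (measurable_itv _).
    rewrite muK => /esym/eqP.
    by rewrite sube_eq ?fin_num_measure// add0e => /eqP <-.
  by rewrite /integral_on Rintegral_cst// mul1r; exact: (congr1 fine muI).
have iX : integral_on (fun t => t ^+ 1) = 0.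
  by rewrite -Rintegral_setT_on// /Rintegral; move: m1; rewrite /moment => ->.
have iX2 : integral_on (fun t => t ^+ 2) = 1.
  by rewrite -Rintegral_setT_on// /Rintegral; move: m2; rewrite /moment => ->.
have cn n : cont_on K (fun t : R => t ^+ n) by move=> t _; exact: cX.
have cc x : cont_on K (fun=> x) by exact: cont_on_cst.
have -> : a + c + e * integral_on u + f * integral_on v =
  integral_on (fun t => a * 1 + b * t ^+ 1 + c * t ^+ 2 + e * u t + f * v t).
  have cM x w : cont_on K w -> cont_on K (fun t => x * w t).
    by move=> cw; exact: cont_on_mul.
  have D w w' : cont_on K w -> cont_on K w' ->
     integral_on (fun t => w t + w' t) = integral_on w + integral_on w'.
    by move=> cw cw'; rewrite /integral_on RintegralD//; exact: cont_on_integrable.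
  have Z x w : cont_on K w -> integral_on (fun t => x * w t) = x * integral_on w.
    by move=> cw; rewrite /integral_on RintegralZl//; exact: cont_on_integrable.
  have c1 := cM a _ (cc 1).
  have c2 := cont_on_add c1 (cM b _ (cn 1%N)).
  have c3 := cont_on_add c2 (cM c _ (cn 2%N)).
  have c4 := cont_on_add c3 (cM e _ cu).
  rewrite D//; last exact: cM.
  rewrite D//; last exact: cM.
  rewrite D//; last exact: cM.
  rewrite D//; last exact: cM.
  by rewrite !Z// i1 iX iX2; ring.
apply: Rintegral_ge0 => t /=; rewrite in_itv/= => tK.
by rewrite mulr1 expr1 H.
Qed.

End Integral.

Lemma inv_complexE {R : realType} (x y t : R) :
  (Complex x y - t%:C%C)^-1 =
  Complex ((x - t) / ((x - t) ^+ 2 + y ^+ 2)) (- (y * ((x - t) ^+ 2 + y ^+ 2)^-1)).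
Proof.
(* This is what the complex inverse computes to; the 0 is the imaginary part of the real number
   t. *)
transitivity (Complex ((x - t) / ((x - t) ^+ 2 + (y - 0) ^+ 2))
  (- ((y - 0) / ((x - t) ^+ 2 + (y - 0) ^+ 2)))) => //.
by rewrite subr0.
Qed.

Section NonrealPoint.
Context {R : realType} (x y : R).
Hypothesis y0 : 0 < y.

Lemma sqD_gt0 t : 0 < (x - t) ^+ 2 + y ^+ 2.
Proof. by rewrite ltr_wpDl ?sqr_ge0 ?exprn_gt0. Qed.

Lemma continuous_poisson : continuous (fun t => ((x - t) ^+ 2 + y ^+ 2)^-1).
Proof.
(* The interval [-|t|, |t|] is chosen only to contain t. *)
move=> t; apply: (@cont_on_poisson _ `|t|); last by rewrite -ler_norml.
by move=> z _; rewrite lt0r_neq0 ?sqD_gt0.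
Qed.

Lemma continuous_cauchy_re :
  continuous (fun t => (x - t) / ((x - t) ^+ 2 + y ^+ 2)).
Proof.
move=> t; apply: (@cont_on_cauchy_re _ `|t|); last by rewrite -ler_norml.
by move=> z _; rewrite lt0r_neq0 ?sqD_gt0.
Qed.

End NonrealPoint.

Lemma cauchy_transform_poisson {R : realType} (mu : probability R R) (K x y : R) :
  mu (~` `[- K, K]%classic) = 0%E -> 0 < y ->
  cauchy_transform mu (Complex x y) =
  Complex (cauchy_re (integral_on mu K) x y) (- (y * poisson (integral_on mu K) x y)).
Proof.
move=> muK y0; rewrite /cauchy_transform.
under eq_fun do rewrite inv_complexE /=.
under [in X in Complex _ X]eq_fun do rewrite inv_complexE /=.
congr Complex.
  by rewrite (Rintegral_setT_on muK)//; exact: continuous_cauchy_re.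
under eq_Rintegral do rewrite -mulNr.
rewrite RintegralZl//; last first.
  by apply: (continuous_integrable muK); exact: continuous_poisson.
by rewrite (Rintegral_setT_on muK) ?mulNr//; exact: continuous_poisson.
Qed.

(** The kernel is bounded by y^-2. This serves the Boolean power, about whose support nothing is
    known yet. *)
Lemma poisson_integrable {R : realType} (nu : probability R R) (x y : R) :
  0 < y -> nu.-integrable setT (EFin \o (fun t => ((x - t) ^+ 2 + y ^+ 2)^-1)).
Proof.
move=> y0; apply: measurable_bounded_integrable => //.
- by rewrite (le_lt_trans (probability_le1 _ _)) ?ltry//.
- by apply: continuous_measurable_fun; exact: continuous_poisson.
- exists (y ^- 2); split; first exact: num_real.
  move=> r yr t _ /=; apply: le_trans (ltW yr).
  have q0 := sqD_gt0 x y0 t.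
  rewrite ger0_norm ?invr_ge0 ?(ltW q0)// lef_pV2 ?posrE ?exprn_gt0//.
  by rewrite lerDr sqr_ge0.
Qed.

Lemma Im_cauchy_transform {R : realType} (nu : probability R R) (x y : R) : 0 < y ->
  (- (complex.Im (cauchy_transform nu (Complex x y))))%:E =
  (\int[nu]_t (y * ((x - t) ^+ 2 + y ^+ 2)^-1)%:E)%E.
Proof.
move=> y0.
have -> : complex.Im (cauchy_transform nu (Complex x y)) =
    - (y * \int[nu]_t ((x - t) ^+ 2 + y ^+ 2)^-1).
  change (\int[nu]_t complex.Im ((Complex x y - t%:C%C)^-1) =
    - (y * \int[nu]_t ((x - t) ^+ 2 + y ^+ 2)^-1)).
  under eq_Rintegral do rewrite inv_complexE /= -mulNr.
  by rewrite RintegralZl//; [rewrite mulNr|exact: poisson_integrable].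
rewrite opprK -RintegralZl//; last exact: poisson_integrable.
rewrite /Rintegral fineK// integrable_fin_num//.
exact: (integrableZl _ _ (poisson_integrable nu x y0)).
Qed.

(** On [x - y, x + y] the integrand y / ((x - t)^2 + y^2) of - Im G_nu is at least 1 / (2 y). *)
Lemma interval_le_cauchy_transform {R : realType} (nu : probability R R) (x y : R) :
  0 < y ->
  (nu `[(x - y)%R, (x + y)%R]%classic <=
    (2 * y * - complex.Im (cauchy_transform nu (Complex x y)))%:E)%E.
Proof.
move=> y0; set A := (X in nu X).
have mA : measurable A by exact: measurable_itv.
have y20 : 0 < (2 * y)^-1 by rewrite invr_gt0 mulr_gt0.
have pos t : (0 <= (y * ((x - t) ^+ 2 + y ^+ 2)^-1)%:E)%E.
  by rewrite lee_fin mulr_ge0 ?invr_ge0 ?(ltW y0) ?(ltW (sqD_gt0 x y0 t)).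
have mf D : measurable_fun D (fun t : R => (y * ((x - t) ^+ 2 + y ^+ 2)^-1)%:E).
  apply/measurable_EFinP; apply: measurable_funTS; apply: continuous_measurable_fun.
  by move=> t; apply: cvgM; [exact: cvg_cst|exact: continuous_poisson].
rewrite EFinM Im_cauchy_transform// -lee_pdivrMl; last by rewrite mulr_gt0.
apply: (@le_trans _ _ (\int[nu]_(t in A) ((2 * y)^-1)%:E)%E).
  by rewrite integral_cst.
apply: (@le_trans _ _ (\int[nu]_(t in A) (y * ((x - t) ^+ 2 + y ^+ 2)^-1)%:E)%E).
  apply: ge0_le_integral => //.
  - by move=> t _; rewrite lee_fin ltW.
  - move=> t; rewrite /A/= in_itv/= => tA; rewrite lee_fin.
    rewrite ler_pdivlMr ?sqD_gt0// mulrC ler_pdivrMr ?mulr_gt0//.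
    case/andP: tA => t1 t2; nra.
apply: ge0_subset_integral => //.
Qed.

(** Cutting an interval into halves replaces l^2 by 2 (l / 2)^2 = l^2 / 2, so k rounds improve the
    bound by 2^k. *)
Lemma null_of_quadratic {R : realType} (nu : probability R R) (C a b : R) :
  (forall c d, a <= c -> c < d -> d <= b ->
    (nu `[c, d]%classic <= (C * (d - c) ^+ 2)%:E)%E) ->
  a < b -> nu `[a, b]%classic = 0%E.
Proof.
move=> H ab.
have Hk k : forall c d, a <= c -> c < d -> d <= b ->
    (nu `[c, d]%classic <= (C * (d - c) ^+ 2 / 2 ^+ k)%:E)%E.
  elim: k => [|k IH] c d ac cd db; first by rewrite expr0 divr1 H.
  pose m := (c + d) / 2.
  have cm : c < m by rewrite /m; lra.
  have md : m < d by rewrite /m; lra.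
  have sub : `[c, d]%classic `<=` `[c, m]%classic `|` `[m, d]%classic.
    move=> t /=; rewrite !in_itv/= => /andP[-> ->]; rewrite andbT.
    by case: (leP t m) => [|/ltW]; [left|right].
  apply: (@le_trans _ _ (nu (`[c, m]%classic `|` `[m, d]%classic))).
    by apply: le_measure => //; rewrite inE//; exact: measurableU.
  apply: le_trans (measureU2 _ _ _) _ => //.
  apply: le_trans (leeD (IH _ _ ac cm (le_trans (ltW md) db)) (IH _ _ (le_trans ac (ltW cm)) md db)) _.
  rewrite -EFinD lee_fin le_eqVlt; apply/orP; left; apply/eqP.
  have p : 2 ^+ k != 0 :> R by rewrite expf_neq0.
  rewrite [2 ^+ k.+1]exprS /m; move: (2 ^+ k) p => q p; by field.
apply/eqP; rewrite -measure_le0; apply/lee_addgt0Pr => e e0; rewrite add0e.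
set D := C * (b - a) ^+ 2 in Hk *.
have D0 : 0 <= D.
  by have := H a b (lexx a) ab (lexx b); rewrite -/D -lee_fin; exact: le_trans.
have [k Dk] : exists k, D / 2 ^+ k <= e.
  exists (Num.bound (D / e)); rewrite ler_pdivrMr ?exprn_gt0// mulrC -ler_pdivrMr//.
  apply: ltW.
  apply: lt_le_trans (archi_boundP _) _; first by rewrite divr_ge0// ltW.
  by rewrite -natrX ler_nat ltnW// ltn_expl.
by apply: le_trans (Hk k a b _ _ _) _ => //.
Qed.

(** * Atoms and null intervals of Boolean powers *)

Lemma Im_div_complex {R : realType} (a b c d : R) :
  complex.Im (Complex a b / Complex c d) = (b * c - a * d) / (c ^+ 2 + d ^+ 2).
Proof.
transitivity (a * (- (d / (c ^+ 2 + d ^+ 2))) + b * (c / (c ^+ 2 + d ^+ 2))).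
  by [].
by rewrite mulrBl; ring.
Qed.

Lemma cvg_dist_le_harmonic {R : realType} (u : nat -> R) (l C : R) :
  (forall k, `|u k - l| <= C * harmonic k) -> u @ \oo --> l.
Proof.
move=> H; apply/cvgrPdist_le => e e0.
have /cvgrPdist_le/(_ e e0) : (fun k => C * @harmonic R k) @ \oo --> 0.
  by rewrite -(mulr0 C); apply: cvgM; [exact: cvg_cst|exact: cvg_harmonic].
apply: filterS => k; rewrite sub0r normrN => Hk.
by rewrite distrC (le_trans (H k))// (le_trans _ Hk)// ler_norm.
Qed.

Section BooleanPower.
Context {R : realType} (mu nu : probability R R) (K : R) (n : nat).
Hypotheses (muK : mu (~` `[- K, K]%classic) = 0%E)
  (HE : standardized K (integral_on mu K)) (Hb : is_boolean_power mu n nu).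
Let E := integral_on mu K.
Local Notation g := (cauchy_re E).
Local Notation s := (poisson E).
Local Notation G := (cauchy_real E).
Local Notation S := (cauchy_sq E).
Let N : R := n%:R.

(** With G = g - i y s one has z G = (x g + y^2 s) + i y (g - x s), and G_nu = G / (N - (N - 1) z
    G). Pulling out y exhibits Im G_nu as O(y) where the denominator stays away from zero. *)
Lemma Im_cauchy_boolean_power (x y : R) : 0 < y ->
  - complex.Im (cauchy_transform nu (Complex x y)) =
  y * (s x y * (N - (N - 1) * (x * g x y + y ^+ 2 * s x y)) -
       (N - 1) * g x y * (g x y - x * s x y)) /
  ((N - (N - 1) * (x * g x y + y ^+ 2 * s x y)) ^+ 2 +
   ((N - 1) * y * (g x y - x * s x y)) ^+ 2).
Proof.
move=> y0; have := @Hb (Complex x y) y0.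
rewrite /K_transform /F_transform.
have s0 : 0 < s x y by exact: (poisson_gt0 HE x y0).
have := @cauchy_transform_poisson R mu K x y muK y0; rewrite -/E => Gmu.
(* Its imaginary part is - y s(x, y) < 0; solving for G_nu divides by it. *)
have Gmu0 : cauchy_transform mu (Complex x y) != 0.
  rewrite Gmu; apply/eqP => /(congr1 (@complex.Im R)) /= /eqP.
  by rewrite oppr_eq0 mulf_eq0 !gt_eqF.
set Gm := cauchy_transform mu _ in Gmu Gmu0 *.
set Gn := cauchy_transform nu _; set z := Complex x y => H.
have GnV : Gn^-1 = (n%:R - (n%:R - 1) * z * Gm) / Gm.
  have -> : Gn^-1 = z - (z - Gn^-1) by ring.
  by rewrite H; field.
rewrite -[Gn]invrK GnV invf_div.
have -> : n%:R - (n%:R - 1) * z * Gm =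
  Complex (N - (N - 1) * (x * g x y + y ^+ 2 * s x y))
    (- ((N - 1) * y * (g x y - x * s x y))).
  have -> : n%:R = N%:C%C :> R[i] by rewrite /N rmorph_nat.
  rewrite Gmu; apply/eqP; rewrite eq_complex /=; apply/andP; split; apply/eqP; ring.
rewrite Gmu Im_div_complex sqrrN -mulNr; congr (_ / _); ring.
Qed.

Lemma boolean_power_null (x0 : R) : 1 < N -> K < `|x0| -> (N - 1) * x0 * G x0 != N ->
  exists2 e : R, 0 < e & nu (ball x0 e) = 0%E.
Proof.
move=> N1 Kx0 W0neq.
pose W0 := N - (N - 1) * x0 * G x0.
have W0_gt0 : 0 < `|W0| by rewrite normr_gt0 subr_eq0 eq_sym.
set r := (`|x0| - K) / 2.
have r0 : 0 < r by rewrite /r; lra.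
pose A := r^-2; pose C := r^-2 + r^-3.
have A0 : 0 < A by rewrite invr_gt0 exprn_gt0.
have C0 : 0 < C by rewrite addr_gt0 ?invr_gt0 ?exprn_gt0.
pose B := `|x0| + 1; pose M := `|G x0| + 2 * C.
have B0 : 0 < B by rewrite ltr_wpDl.
have M0 : 0 < M by rewrite ltr_wpDl ?mulr_gt0.
(* On the box |x - x0| <= [rho], 0 < y <= [rho], the real part of the denominator differs from [W0]
   by at most [rho] * [D]. *)
pose D := (N - 1) * (B * (2 * C) + `|G x0| + A).
have D0 : 0 < D.
  apply: mulr_gt0; first by rewrite subr_gt0.
  apply: ltr_wpDl => //; apply: addr_ge0 => //.
  by apply/ltW/mulr_gt0 => //; exact: mulr_gt0.
(* The three bounds keep x away from [-K, K], give y^2 <= [rho], and keep the real part of the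
   denominator at least |[W0]| / 2 in absolute value. *)
pose rho := Num.min (Num.min r 1) (`|W0| / (2 * D)).
have rho0 : 0 < rho by rewrite !lt_min r0 ltr01 divr_gt0// mulr_gt0.
have rho_r : rho <= r by rewrite /rho !ge_min lexx.
have rho_1 : rho <= 1 by rewrite /rho !ge_min lexx !orbT.
have rho_W : rho * D <= `|W0| / 2.
  have : rho <= `|W0| / (2 * D) by rewrite /rho !ge_min lexx !orbT.
  by rewrite ler_pdivlMr; [lra|exact: mulr_gt0].
(* The two summands bound the two terms of - Im G_nu / y; they are [T1] and [T2] below. *)
pose Q := 2 * A / `|W0| + 4 * (N - 1) * M * (M + B * A) / W0 ^+ 2.
have main x y : `|x - x0| <= rho -> 0 < y -> y <= rho ->
    - complex.Im (cauchy_transform nu (Complex x y)) <= y * Q.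
  move=> xx0 y0 yr; rewrite Im_cauchy_boolean_power//.
  have fx : @far R K r x by apply: far_near => //; exact: le_trans rho_r.
  have fx0 : @far R K r x0 by apply: far_near => //; rewrite subrr normr0 ltW.
  have sA := poisson_le HE y r0 fx; rewrite -/A -/E in sA.
  have gC := cauchy_re_dist HE y r0 fx fx0; rewrite -/C -/E in gC.
  move: (s x y) (g x y) sA gC => sv gv sA gC.
  have y2 : y ^+ 2 <= rho by nra.
  have gC' : `|gv - G x0| <= 2 * C * rho.
    apply: le_trans gC _; rewrite -mulrA mulrCA ler_pM2l//; lra.
  have gM : `|gv| <= M.
    rewrite -(subrK (G x0) gv) (le_trans (ler_normD _ _))// addrC lerD2l.
    apply: le_trans gC' _; rewrite -[leRHS]mulr1 ler_pM2l//; lra.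
  have xB : `|x| <= B.
    by rewrite -(subrK x0 x) (le_trans (ler_normD _ _))// addrC lerD2l; lra.
  set w := N - (N - 1) * (x * gv + y ^+ 2 * sv).
  have wW : `|w - W0| <= rho * D.
    have -> : w - W0 = - ((N - 1) * (x * (gv - G x0) + (x - x0) * G x0 + y ^+ 2 * sv)).
      by rewrite /w /W0; ring.
    rewrite normrN normrM (ger0_norm (ltW _)) ?subr_gt0//.
    rewrite /D mulrCA ler_pM2l ?subr_gt0//.
    have -> : rho * (B * (2 * C) + `|G x0| + A) =
      B * (2 * C * rho) + rho * `|G x0| + rho * A by ring.
    apply: le_trans (ler_normD _ _) _; apply: lerD.
      apply: le_trans (ler_normD _ _) _; apply: lerD; rewrite normrM.
        by rewrite ler_pM.
      by rewrite ler_wpM2r.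
    by rewrite normrM ger0_norm ?sqr_ge0// ler_pM ?sqr_ge0.
  have wl : `|W0| / 2 <= `|w|.
    have := lerB_dist W0 w; rewrite distrC; lra.
  have w0 : 0 < `|w| by apply: lt_le_trans wl; rewrite divr_gt0.
  have w20 : 0 < w ^+ 2 by rewrite -real_normK ?num_real// exprn_gt0.
  rewrite -mulrA ler_pM2l//.
  set den := w ^+ 2 + _.
  have den_w : w ^+ 2 <= den by rewrite /den lerDl sqr_ge0.
  have den0 : 0 < den by exact: lt_le_trans den_w.
  have T1 : `|sv * w / den| <= 2 * A / `|W0|.
    rewrite normrM normrM normfV (gtr0_norm den0) ler_pdivrMr//.
    apply: (@le_trans _ _ (2 * A / `|W0| * w ^+ 2)); last first.
      by rewrite ler_pM2l// divr_gt0// mulr_gt0.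
    rewrite -[w ^+ 2]real_normK ?num_real// expr2 mulrA ler_pM2r//.
    apply: le_trans sA _; rewrite mulrAC ler_pdivlMr//; nra.
  have T2 : `|(N - 1) * gv * (gv - x * sv) / den| <= 4 * (N - 1) * M * (M + B * A) / W0 ^+ 2.
    have W02 : 0 < W0 ^+ 2 by rewrite -real_normK ?num_real// exprn_gt0.
    have denW : W0 ^+ 2 / 4 <= den.
      apply: le_trans den_w.
      rewrite -[W0 ^+ 2]real_normK ?num_real// -[w ^+ 2]real_normK ?num_real//; nra.
    have N10 : 0 <= N - 1 by lra.
    rewrite normrM normfV (gtr0_norm den0) ler_pdivrMr//.
    apply: (@le_trans _ _ (4 * (N - 1) * M * (M + B * A) / W0 ^+ 2 * (W0 ^+ 2 / 4))).
      have -> : 4 * (N - 1) * M * (M + B * A) / W0 ^+ 2 * (W0 ^+ 2 / 4) =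
          (N - 1) * M * (M + B * A).
        have W0n : W0 != 0 by rewrite -normr_gt0.
        by field.
      rewrite !normrM (ger0_norm N10) ler_pM ?mulr_ge0//.
        by rewrite ler_wpM2l.
      apply: le_trans (ler_normB _ _) _; apply: lerD => //.
      by rewrite normrM ler_pM.
    apply: ler_wpM2l => //; apply: divr_ge0; last exact: ltW.
    apply: mulr_ge0; first by rewrite !mulr_ge0// ltW.
    by apply/ltW/addr_gt0 => //; exact: mulr_gt0.
  rewrite mulrBl; apply: le_trans (ler_norm _) _.
  by apply: le_trans (ler_normB _ _) _; rewrite lerD.
exists rho => //.
have null : nu `[x0 - rho, x0 + rho]%classic = 0%E.
  apply: (@null_of_quadratic _ nu (Q / 2)); last by rewrite ltrD2l gt0_cp.
  move=> c d ac cd db; pose x := (c + d) / 2; pose y := (d - c) / 2.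
  have -> : c = x - y by rewrite /x /y; field.
  have -> : d = x + y by rewrite /x /y; field.
  have y0 : 0 < y by rewrite /y; lra.
  apply: le_trans (interval_le_cauchy_transform nu x y0) _; rewrite lee_fin.
  have -> : Q / 2 * (x + y - (x - y)) ^+ 2 = 2 * y * (y * Q) by field.
  rewrite ler_pM2l; last exact: mulr_gt0.
  apply: main => //.
    by rewrite ler_norml /x; apply/andP; split; lra.
  by rewrite /y; lra.
apply: (subset_measure0 _ _ _ null) => //.
  exact: measurable_ball.
by move=> t; rewrite ball_itv /= !in_itv/= => /andP[/ltW-> /ltW->].
Qed.

(** The functions y^2 / ((X - t)^2 + y^2) are bounded by 1 and tend to the indicator of {X} as y = 1
    / (k + 1) decreases to 0; dominated convergence applies. *)
Lemma atom_cvg (X : R) :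
  (fun k => @harmonic R k * - complex.Im (cauchy_transform nu (Complex X (harmonic k))))
    @ \oo --> fine (nu [set X]).
Proof.
pose f k t := @harmonic R k ^+ 2 / ((X - t) ^+ 2 + harmonic k ^+ 2).
have h0 k : 0 < @harmonic R k by rewrite /harmonic invr_gt0 ltr0Sn.
have fE k : (\int[nu]_t (f k t)%:E)%E =
    (harmonic k * - complex.Im (cauchy_transform nu (Complex X (harmonic k))))%:E.
  rewrite EFinM Im_cauchy_transform// -ge0_integralZl//.
  - by apply: eq_integral => t _; rewrite -EFinM /f expr2 mulrA.
  - apply/measurable_EFinP; apply: continuous_measurable_fun => t.
    by apply: cvgM; [exact: cvg_cst|exact: continuous_poisson].
  - by move=> t _; rewrite lee_fin mulr_ge0 ?invr_ge0 ?(ltW (h0 k)) ?(ltW (sqD_gt0 X (h0 k) t)).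
  - by rewrite lee_fin ltW.
have mf k : measurable_fun setT (fun t => (f k t)%:E).
  apply/measurable_EFinP; apply: continuous_measurable_fun => t.
  by apply: cvgM; [exact: cvg_cst|exact: continuous_poisson].
have h1 k : @harmonic R k <= 1 by rewrite invf_le1 ?ltr0Sn// ler1n.
have f01 k t : (`|(f k t)%:E| <= 1)%E.
  have q0 := sqD_gt0 X (h0 k) t.
  have f0 : 0 <= f k t by apply: divr_ge0; [exact: sqr_ge0|exact: ltW].
  rewrite abse_EFin lee_fin ger0_norm// /f.
  by rewrite ler_pdivrMr// mul1r lerDr sqr_ge0.
have [||||_ _] := @dominated_convergence _ _ R nu setT measurableT
  (fun k t => (f k t)%:E) (fun t => (\1_[set X] t)%:E) (fun=> 1%E) mf.
- by apply/measurable_EFinP; exact: measurable_indic.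
- apply: aeW => /= z _; apply: cvg_EFin; first exact: nearW.
  case: (eqVneq z X) => [->|tX].
    rewrite indicE mem_set//=; apply: cvg_near_cst; apply: nearW => i /=.
    by rewrite /f subrr expr0n add0r divff// expf_neq0// gt_eqF.
  rewrite indicE memNset//=; last by move=> /eqP; rewrite (negbTE tX).
  have Xt : 0 < (X - z) ^+ 2.
    by rewrite -real_normK ?num_real// exprn_gt0// normr_gt0 subr_eq0 eq_sym.
  apply: (@cvg_dist_le_harmonic _ _ _ ((X - z)^-2)) => i /=.
  have qz := sqD_gt0 X (h0 i) z.
  rewrite subr0 /f ger0_norm; last by rewrite divr_ge0 ?sqr_ge0 ?(ltW qz).
  rewrite [leRHS]mulrC.
  apply: ler_pM; rewrite ?invr_ge0 ?sqr_ge0 ?(ltW qz)//.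
    by rewrite expr2 ler_piMl ?h1// ltW ?h0.
  by rewrite lef_pV2 ?posrE// lerDl sqr_ge0.
- exact: finite_measure_integrable_cst.
- by apply: aeW => z i _; exact: f01.
rewrite integral_indic// setIT; set w := (X in _ --> X).
have -> : w = (fine (nu [set X]))%:E by apply/esym/fineK; exact: fin_num_measure.
move=> /fine_cvg.
rewrite (_ : fine \o _ = (fun k => @harmonic R k *
  - complex.Im (cauchy_transform nu (Complex X (harmonic k)))))//.
by apply/funext => k /=; rewrite fE.
Qed.

Lemma boolean_power_atom (X : R) : 1 < N -> K < `|X| -> (N - 1) * X * G X = N ->
  X * S X - G X != 0 -> fine (nu [set X]) = G X / ((N - 1) * (X * S X - G X)).
Proof.
move=> N1 KX WX slope.
set r := (`|X| - K) / 2.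
have r0 : 0 < r by rewrite /r; lra.
have fX : @far R K r X by apply: far_near => //; rewrite subrr normr0 ltW.
have h0 k : 0 < @harmonic R k by rewrite /harmonic invr_gt0 ltr0Sn.
have h1 k : @harmonic R k <= 1 by rewrite invf_le1 ?ltr0Sn// ler1n.
pose h := @harmonic R.
pose C := r^-2 + r^-3.
have C0 : 0 < C by rewrite addr_gt0 ?invr_gt0 ?exprn_gt0.
have gd k : `|g X (h k) - G X| <= C * h k ^+ 2.
  by have := cauchy_re_dist HE (h k) r0 fX fX; rewrite subrr normr0 add0r.
have hh k : h k ^+ 2 <= h k by rewrite /h expr2 ler_piMl ?h1// ltW ?h0.
have gG : (fun k => g X (h k)) @ \oo --> G X.
  apply: (@cvg_dist_le_harmonic _ _ _ C) => k.
  by apply: le_trans (gd k) _; rewrite ler_pM2l.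
have sS : (fun k => s X (h k)) @ \oo --> S X.
  apply: (@cvg_dist_le_harmonic _ _ _ (r^-4)) => k.
  apply: le_trans (poisson_dist HE (h k) r0 fX) _.
  by rewrite ler_pM2l// invr_gt0 exprn_gt0.
(* The real part of the denominator over y. At a zero that real part is O(y^2), so [a] tends to
   0. *)
pose a k := (N - (N - 1) * (X * g X (h k) + h k ^+ 2 * s X (h k))) / h k.
have a0 : a @ \oo --> 0.
  apply: (@cvg_dist_le_harmonic _ _ _ ((N - 1) * (`|X| * C + r^-2))) => k.
  rewrite subr0 /a; move: (gd k) (poisson_le HE (h k) r0 fX) (h0 k).
  rewrite -/E; move: (g X (h k)) (s X (h k)) => gv sv; rewrite -/(h k).
  move: (h k) => y gy sy y0.
  have -> : (N - (N - 1) * (X * gv + y ^+ 2 * sv)) / y =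
     - ((N - 1) * (X * (gv - G X) + y ^+ 2 * sv)) / y.
    by congr (_ / _); rewrite -{1}WX; ring.
  rewrite normrM normfV (gtr0_norm y0) ler_pdivrMr// normrN normrM.
  rewrite ger0_norm; last by lra.
  have -> : (N - 1) * (`|X| * C + r^-2) * y * y =
     (N - 1) * (`|X| * (C * y ^+ 2) + y ^+ 2 * r^-2) by ring.
  rewrite ler_pM2l; last by lra.
  apply: le_trans (ler_normD _ _) _; apply: lerD; rewrite normrM.
    by rewrite ler_wpM2l.
  by rewrite ger0_norm ?sqr_ge0// ler_wpM2l ?sqr_ge0.
have bb : (fun k => (N - 1) * (g X (h k) - X * s X (h k))) @ \oo -->
    (N - 1) * (G X - X * S X).
  apply: cvgM; first exact: cvg_cst.
  by apply: cvgB => //; apply: cvgM => //; exact: cvg_cst.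
have h_cvg : h @ \oo --> 0 by exact: cvg_harmonic.
have lim2 : (fun k => h k * - complex.Im (cauchy_transform nu (Complex X (h k)))) @ \oo -->
  (0 * S X * 0 - G X * ((N - 1) * (G X - X * S X))) /
  (0 ^+ 2 + ((N - 1) * (G X - X * S X)) ^+ 2).
  (* Numerator and denominator are divided by y^2, after which both converge and the limit of the
     denominator is nonzero. *)
  rewrite [X in X @ _ --> _](_ : _ = (fun k =>
    (h k * s X (h k) * a k - g X (h k) * ((N - 1) * (g X (h k) - X * s X (h k)))) /
    (a k ^+ 2 + ((N - 1) * (g X (h k) - X * s X (h k))) ^+ 2))); last first.
    apply/funext => k; rewrite Im_cauchy_boolean_power// -/E -/N.
    rewrite /a; have y0 : h k != 0 by rewrite gt_eqF// h0.
    rewrite -/(h k); set w := (X in X ^+ 2 + ((N - 1) * h k * _) ^+ 2).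
    set y := h k in y0 w *.
    set q := g X _ - _.
    have -> : (w / y) ^+ 2 + ((N - 1) * q) ^+ 2 =
      (w ^+ 2 + ((N - 1) * y * q) ^+ 2) / y ^+ 2 by field.
    rewrite invf_div; move: (_ + _)^-1 => p.
    by field.
  apply: cvgM.
    apply: cvgB; last exact: cvgM.
    by apply: cvgM => //; exact: cvgM.
  apply: cvgV; last by apply: cvgD; rewrite expr2; exact: cvgM.
  rewrite expr0n add0r expf_neq0// mulf_neq0//; first by rewrite gt_eqF// subr_gt0.
  by rewrite -oppr_eq0 opprB.
have -> := cvg_unique (@Rhausdorff R) (@atom_cvg X) lim2.
have N10 : N - 1 != 0 by rewrite gt_eqF// subr_gt0.
have slope' : G X - X * S X != 0 by rewrite -oppr_eq0 opprB.
by field; rewrite N10 slope slope'.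
Qed.
End BooleanPower.

(* [X] is the unscaled position of the atom and [q] its mass; if there is no
   zero to the right of [K], which forces [r <= 2 * K], any [X] in range will
   do, with mass 0. *)
Lemma zero_or_placeholder {R : realType} (K r : R) (E : (R -> R) -> R) :
  0 < K -> standardized K E -> K < r ->
  let N := r ^+ 2 in let G := cauchy_real E in let S := cauchy_sq E in
  let d := K / r in
  exists X q, [/\ K < X, `|X - r| <= K,
    forall Y, K < Y -> (N - 1) * Y * G Y = N -> Y = X,
    [/\ (N - 1) * X * G X = N, X * S X - G X != 0 &
        q = G X / ((N - 1) * (X * S X - G X))] \/
    (N - 1) * X * G X != N /\ q = 0 &
    [/\ q <= 1 / 2 + d / 2, 1 / 2 - 2 * d <= q &
        d <= 1 / 4 -> 1 / 2 - 2 / 5 * d <= q]].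
Proof.
move=> K0 HE Kr N G S d.
have K1 : 1 <= K := bound_ge1 HE K0.
have r0 : 0 < r by lra.
have N1 : 1 < N by rewrite /N; nra.
have dr : d * r = K by rewrite /d divfK// gt_eqF.
have d0 : 0 < d by rewrite divr_gt0.
case: (pselect (exists2 X, K < X & (N - 1) * X * G X = N)) => [[X KX XN]|noz].
  have Xr : `|X - r| <= K.
    have := zero_upper HE N1 KX XN; have := zero_lower K0 HE N1 KX XN.
    rewrite ler_norml /N => H1 H2; apply/andP; split; nra.
  exists X, (G X / ((N - 1) * (X * S X - G X))); split => //.
  - move=> Y KY YN; apply/eqP; rewrite eq_le; apply/andP; split; rewrite leNgt; apply/negP.
      move=> /(mul_cauchy_real_decr K0 HE KX).
      by rewrite -(ltr_pM2l (_ : 0 < N - 1)) ?subr_gt0// !mulrA XN YN ltxx.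
    move=> /(mul_cauchy_real_decr K0 HE KY).
    by rewrite -(ltr_pM2l (_ : 0 < N - 1)) ?subr_gt0// !mulrA XN YN ltxx.
  - left; split => //; apply: lt0r_neq0; exact: (zero_slope_gt0 K0 HE N1 KX XN).
  have qu := zero_mass_upper K0 HE N1 KX XN.
  have ql := zero_mass_lower K0 HE N1 KX XN.
  rewrite /zero_mass -/G -/S in qu ql.
  move: (G X / _) qu ql => q qu ql.
  have X0 : 0 < X by lra.
  have q_ge0 : 0 <= q by apply: le_trans ql; rewrite divr_ge0//; lra.
  (* The lower bound is 1 / 2 - K / (2 (2 X - K)), and 2 X - K >= 2 r - 3 K >= 5 r / 4 when r >= 4
     K. *)
  have ql' : d <= 1 / 4 -> 1 / 2 - 2 / 5 * d <= q.
    move=> d4; apply: le_trans ql; rewrite ler_pdivlMr; last by lra.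
    move: Xr; rewrite ler_norml => /andP[Xr _].
    have Kr4 : 4 * K <= r by rewrite -dr; nra.
    rewrite -dr in Xr KX Kr4 *; nra.
  split => //; last first.
    case: (leP d (1 / 4)) => d4; last by lra.
    by have := ql' d4; lra.
  apply: le_trans qu _; rewrite ler_pdivrMr; last by rewrite /N; nra.
  have := zero_lower K0 HE N1 KX XN.
  have -> : (1 / 2 + d / 2) * (N + X ^+ 2) = (1 + d) * (N + X ^+ 2) / 2 by ring.
  rewrite ler_pdivlMr// /N => H.
  have dlt : d < 1 by rewrite /d ltr_pdivrMr// mul1r.
  (* If X >= r the mass is at most 1 / 2. Otherwise X^2 >= r^2 - d r X by [zero_lower], and the
     claim reduces to 2 r - X - d X >= 0. *)
  case: (leP r X) => rX; first by nra.
  have : 0 <= d * r * (2 * r - X - d * X).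
    have dX : d * X <= X by rewrite ler_piMl ?ltW.
    by apply: mulr_ge0; [apply: mulr_ge0; exact: ltW|lra].
  rewrite -dr in H; nra.
have rK : r <= 2 * K.
  rewrite leNgt; apply/negP => Kr2; apply: noz.
  by apply: (zero_exists K0 HE (ltW r0) _ Kr2).
(* Hence 1 / 2 - 2 d is negative and d <= 1 / 4 is false, so mass 0 meets all three bounds. *)
have d2 : 1 / 2 <= d by rewrite /d ler_pdivlMr//; lra.
exists (r + K), 0; split => //.
- lra.
- by rewrite addrAC subrr add0r gtr0_norm.
- by move=> Y KY YN; exfalso; apply: noz; exists Y.
- right; split => //; apply/eqP => XN; apply: noz; exists (r + K) => //; lra.
- split; lra.
Qed.

(** * Both half-lines combined by reflection *)

Section Assembly.
Context {R : realType} (mu nu : probability R R) (K r : R) (n : nat).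
Hypotheses (K0 : 0 < K) (muK : mu (~` `[- K, K]%classic) = 0%E)
  (HE : standardized K (integral_on mu K)) (Hb : is_boolean_power mu n nu)
  (Kr : K < r) (rn : r ^+ 2 = n%:R).

(** Oddness follows from positivity alone, applied to u + (- u) = 0 and to its negative. *)
Lemma standardized_opp u : cont_on K u ->
  integral_on mu K (fun t => - u t) = - integral_on mu K u.
Proof.
move=> cu; have cu' := cont_on_opp cu.
have := @HE 0 0 0 1 1 _ _ cu cu'; have := @HE 0 0 0 (-1) (-1) _ _ cu cu'.
move=> H1 H2; apply/eqP; rewrite eq_le; apply/andP; split.
  suff : 0 <= 0 + 0 + -1 * integral_on mu K u + -1 * integral_on mu K (fun t => - u t) by lra.
  by apply: H1 => t _; lra.
suff : 0 <= 0 + 0 + 1 * integral_on mu K u + 1 * integral_on mu K (fun t => - u t) by lra.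
by apply: H2 => t _; lra.
Qed.

Let E' (u : R -> R) := integral_on mu K (fun t => u (- t)).

Lemma cauchy_real_flip X : K < X -> cauchy_real (integral_on mu K) (- X) = - cauchy_real E' X.
Proof.
move=> KX; rewrite /cauchy_real /E' -standardized_opp.
  by congr (integral_on mu K _); apply/funext => t; rewrite -invrN; congr (_^-1); ring.
by apply: cont_on_flip (cont_on_inv_right KX).
Qed.

Lemma cauchy_sq_flip X : cauchy_sq (integral_on mu K) (- X) = cauchy_sq E' X.
Proof.
rewrite /cauchy_sq /E'; congr (integral_on mu K _); apply/funext => t.
by congr (_^-1); ring.
Qed.

Lemma boolean_power_structure : let d := K / r in
  exists X1 X2 : R, [/\ `|- X1 - r| <= K, K < - X1, `|X2 - r| <= K, K < X2 &
    [/\ forall x, K < `|x| -> x != X1 -> x != X2 ->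
          exists2 e : R, 0 < e & nu (ball x e) = 0%E,
        [/\ fine (nu [set X1]) <= 1 / 2 + d / 2, 1 / 2 - 2 * d <= fine (nu [set X1]) &
          d <= 1 / 4 -> 1 / 2 - 2 / 5 * d <= fine (nu [set X1])] &
        [/\ fine (nu [set X2]) <= 1 / 2 + d / 2, 1 / 2 - 2 * d <= fine (nu [set X2]) &
          d <= 1 / 4 -> 1 / 2 - 2 / 5 * d <= fine (nu [set X2])]]].
Proof.
move=> d; have K_gt0 := K0.
have [X2 [q2 [KX2 X2r uni2 alt2 bnd2]]] := zero_or_placeholder K0 HE Kr.
(* Here [X1] is the positive mirror image; the left atom is at - [X1]. *)
have [X1 [q1 [KX1 X1r uni1 alt1 bnd1]]] := zero_or_placeholder K0 (standardized_flip HE) Kr.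
rewrite rn in uni1 uni2 alt1 alt2.
rewrite -/E' in uni1 alt1.
have K1 : 1 <= K := bound_ge1 HE K0.
have N1 : 1 < n%:R :> R by rewrite -rn; have K_lt_r := Kr; nra.
have null x := boolean_power_null muK HE Hb (x0 := x) N1.
have point0 x : K < `|x| -> (n%:R - 1) * x * cauchy_real (integral_on mu K) x != n%:R ->
    fine (nu [set x]) = 0.
  move=> Kx /(null x Kx)[e e0 xe].
  have : nu [set x] = 0%E.
    apply: (subset_measure0 _ _ _ xe) => //; first exact: measurable_ball.
    by move=> _ ->; exact: ballxx.
  by move=> ->.
have q2E : fine (nu [set X2]) = q2.
  have KX2n : K < `|X2| by rewrite gtr0_norm// (lt_trans K0).
  case: alt2 => [[z s ->]|[z ->]]; last exact: point0.
  exact: (boolean_power_atom muK HE Hb).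
have q1E : fine (nu [set (- X1)]) = q1.
  have KX1n : K < `|- X1| by rewrite normrN gtr0_norm// (lt_trans K0).
  case: alt1 => [[z s ->]|[z ->]]; last first.
    by apply: point0 => //; rewrite cauchy_real_flip// [_ * - X1]mulrN mulrNN.
  have sN : - X1 * cauchy_sq E' X1 - - cauchy_real E' X1 =
      - (X1 * cauchy_sq E' X1 - cauchy_real E' X1) by ring.
  rewrite (boolean_power_atom muK HE Hb) ?cauchy_real_flip ?cauchy_sq_flip ?sN//.
  - by rewrite mulrN invrN mulrNN.
  - by rewrite [_ * - X1]mulrN mulrNN.
  - by rewrite oppr_eq0.
exists (- X1), X2; rewrite opprK; split => //; rewrite q1E q2E; split => //.
move=> x Kx x1 x2; apply: null => //; apply/eqP => zx.
have [x0|x0] := leP 0 x.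
  move/eqP: x2; apply; apply: uni2 => //; by rewrite ger0_norm in Kx.
rewrite ltr0_norm// in Kx.
move/eqP: x1; apply; rewrite -[x]opprK; congr (- _); apply: uni1 => //.
have := cauchy_real_flip Kx; rewrite opprK => Gx.
by rewrite -[RHS]zx Gx; ring.
Qed.
End Assembly.

(** * Support, dilation and the rescaled power *)

Lemma not_msupport {R : realType} (nu : {measure set R -> \bar R}) (x : R) :
  ~ msupport nu x <-> exists2 e : R, 0 < e & nu (ball x e) = 0%E.
Proof.
split=> [/existsNP[e /not_implyP[e0 /negP]]|[e e0 xe] /(_ e e0)]; last by rewrite xe ltxx.
by rewrite -leNgt measure_le0 => /eqP ?; exists e.
Qed.

Lemma msupport_null {R : realType} (nu : {measure set R -> \bar R}) (U : set R) :
  measurable U -> (forall x, U x -> ~ msupport nu x) -> nu U = 0%E.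
Proof. by move=> mU H; apply: locally_null => // x /H /not_msupport. Qed.

Section Dilation.
Context {R : realType} (nu : set R -> \bar R) (r : R).
Hypothesis r0 : 0 < r.

Lemma dilate_set1 x : dilate r^-1 nu [set x / r] = nu [set x].
Proof.
rewrite /dilate; congr nu; apply/seteqP; split => y /=; last by move=> ->; rewrite mulrC.
by rewrite mulrC => /(mulIf (invr_neq0 (lt0r_neq0 r0))).
Qed.

Lemma dilate_itv a : dilate r^-1 nu `[- (a / r), a / r]%classic = nu `[- a, a]%classic.
Proof.
rewrite /dilate; congr nu; apply/seteqP; split => y /=;
  by rewrite !in_itv/= -mulNr [r^-1 * y]mulrC !ler_pM2r ?invr_gt0.
Qed.

Lemma distr_fun_dilate x : distr_fun (dilate r^-1 nu) x = fine (nu `]-oo, (r * x)]%classic).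
Proof.
rewrite /distr_fun /dilate; congr (fine (nu _)); apply/seteqP; split => y /=;
  by rewrite !in_itv/= ler_pdivrMl.
Qed.

Lemma dilate_ball x e : dilate r^-1 nu (ball x (e / r)) = nu (ball (r * x) e).
Proof.
rewrite /dilate; congr nu; apply/seteqP; split => y /=; rewrite !ball_itv /= !in_itv/=;
  by rewrite [r^-1 * y]mulrC ltr_pdivlMr// ltr_pdivrMr// mulrBl mulrDl
    !divfK ?gt_eqF// [x * r]mulrC.
Qed.

End Dilation.

Lemma distr_fun_bern {R : realType} (x : R) :
  distr_fun (@bern R) x = if x < -1 then 0 else if x < 1 then 1 / 2 else 1.
Proof.
rewrite /distr_fun /bern /= !indicE.
have m (y : R) : (y \in `]-oo, x]%classic) = (y <= x) by rewrite mem_setE in_itv.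
rewrite !m; case: (ltP x (-1)) => x1; case: (ltP x 1) => x2 /=; lra.
Qed.

Theorem theorem2 (R : realType) (mu : probability R R) (K : R) (hK : 0 < K)
  (m1 : moment 1 mu = 0%E) (m2 : moment 2 mu = 1%E)
  (hsupp : msupport mu `<=` `[- K, K]%classic) :
  forall (n : nat) (nu : probability R R),
    (1 <= n)%N -> is_boolean_power mu n nu ->
    K < Num.sqrt (n%:R) ->
    let mun := dilate (Num.sqrt (n%:R))^-1 nu in
    let d := K / Num.sqrt (n%:R) in
    (exists x1 x2 : R,
      [/\ msupport mun `<=` `[- d, d]%classic `|` ([set x1] `|` [set x2]),
          `|-1 - x1| <= d, `|1 - x2| <= d &
          let p := fine (mun [set x1]) in
          let q := fine (mun [set x2]) in
          let r := fine (mun `[- d, d]%classic) in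
          [/\ 1/2 - 2 * d <= p /\ p <= 1/2 + d / 2,
              1/2 - 2 * d <= q /\ q <= 1/2 + d / 2 &
              r < 4 * d]]) /\
    levy_dist (distr_fun mun) (distr_fun (@bern R)) <= 2 * d.
Proof.
move=> n nu _ Hb; set r := Num.sqrt _ => Kr mun d.
have rn : r ^+ 2 = n%:R by rewrite sqr_sqrtr.
have r0 : 0 < r by exact: lt_trans Kr.
have d0 : 0 < d by rewrite divr_gt0.
have d1 : d < 1 by rewrite ltr_pdivrMr// mul1r.
have dr : d * r = K by rewrite /d divfK// gt_eqF.
have muK : mu (~` `[- K, K]%classic) = 0%E.
  apply: msupport_null; first exact: measurableC.
  by move=> x xK /hsupp.
have HE := integral_standardized muK m1 m2.
have [X1 [X2 [X1r KX1 X2r KX2 [null [p_up p_lo p_lo'] [q_up q_lo q_lo']]]]] :=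
  boolean_power_structure hK muK HE Hb Kr rn.
rewrite -/d in p_up p_lo p_lo' q_up q_lo q_lo'.
move: X1r X2r; rewrite !ler_norml => /andP[X1r X1r'] /andP[X2r X2r'].
have dist (a b : R) : `|b - r * a| <= K -> `|a - b / r| <= d.
  move=> bra; have -> : a - b / r = - ((b - r * a) / r) by field; rewrite gt_eqF.
  by rewrite normrN normrM normfV (gtr0_norm r0) ler_pM2r ?invr_gt0.
pose p := fine (nu [set X1]); pose q := fine (nu [set X2]).
have fin (A : set R) : measurable A -> nu A \is a fin_num by move=> ?; exact: fin_num_measure.
have le_fine (A B : set R) : measurable A -> measurable B -> A `<=` B ->
    fine (nu A) <= fine (nu B).
  by move=> mA mB AB; rewrite fine_le ?fin// le_measure ?inE.
have fine_le1 (A : set R) : measurable A -> fine (nu A) <= 1.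
  by move=> mA; rewrite -lee_fin fineK ?fin//; exact: probability_le1.
have fineC (A : set R) : measurable A -> fine (nu (~` A)) = 1 - fine (nu A).
  by move=> mA; rewrite probability_setC// fineB ?fin.
have supp x : msupport nu x -> x != X1 -> x != X2 -> - K <= x <= K.
  move=> nux x1 x2; rewrite -ler_norml leNgt; apply/negP => Kx.
  by have /not_msupport := null x Kx x1 x2.
have fineU (A B : set R) : measurable A -> measurable B -> A `&` B = set0 ->
    fine (nu (A `|` B)) = fine (nu A) + fine (nu B).
  by move=> mA mB AB; rewrite -fineD ?fin// measureU.
have X12 : X1 < X2 by lra.
split; last first.
  (* The Lévy bound is checked in unscaled coordinates, where the support lies in [X1, X2]. *)
  pose Phi z := fine (nu `]-oo, z]%classic).
  have Phi0 z : z < X1 -> Phi z = 0.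
    move=> zX; rewrite /Phi msupport_null// => x; rewrite /= in_itv/= => xz /supp.
    have xX1 : x < X1 by exact: le_lt_trans zX.
    rewrite !lt_eqF// ?(lt_trans xX1)// => /(_ isT isT) /andP[+ _]; lra.
  have Phi1 z : X2 <= z -> Phi z = 1.
    move=> zX; have : fine (nu (~` `]-oo, z]%classic)) = 0.
      rewrite msupport_null//; first exact: measurableC.
      move=> x; rewrite /= in_itv/= => /negP; rewrite -ltNge => xz /supp.
      have xX2 : X2 < x by exact: le_lt_trans xz.
      rewrite !gt_eqF// ?(lt_trans X12)// => /(_ isT isT) /andP[_]; lra.
    by rewrite fineC// -/(Phi z) => H; lra.
  have Phi_q z : z < X2 -> Phi z <= 1 - q.
    move=> zX; rewrite /q -fineC//; apply: le_fine => //; first exact: measurableC.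
    by move=> x /=; rewrite in_itv/= => xz xX2; move: zX; rewrite ltNge -xX2 xz.
  have Phi_p z : X1 <= z -> p <= Phi z.
    by move=> zX; apply: le_fine => // x ->; rewrite /= in_itv.
  have Phi_ge0 z : 0 <= Phi z by rewrite fine_ge0.
  have Phi_le1 z : Phi z <= 1 by exact: fine_le1.
  (* It suffices that 2 d is admissible. Unscaled, the shift is 2 K, which moves past [X1] and [X2]
     because they lie within K of -r and r. *)
  apply: ge_inf; first by exists 0 => e [/ltW].
  split=> [|x]; first by rewrite mulr_gt0.
  rewrite !distr_fun_dilate// distr_fun_bern -!/(Phi _).
  have := Phi_le1 (r * (x - 2 * d)); have := Phi_ge0 (r * (x + 2 * d)).
  have E1 : r * (x - 2 * d) = r * x - 2 * K by rewrite -dr; ring.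
  have E2 : r * (x + 2 * d) = r * x + 2 * K by rewrite -dr; ring.
  rewrite E1 E2 => h0 h1.
  case: (ltP x (-1)) => x1.
    have xr : r * x < - r by nra.
    by rewrite Phi0; [split; lra|lra].
  case: (ltP x 1) => x2.
    have xr : r * x < r by nra.
    have xr' : - r <= r * x by nra.
    have := Phi_q (r * x - 2 * K) => /(_ _)/wrap[]; first lra.
    have := Phi_p (r * x + 2 * K) => /(_ _)/wrap[]; first lra.
    rewrite -/p -/q in p_lo q_lo; lra.
  have xr : r <= r * x by nra.
  by rewrite (Phi1 (r * x + 2 * K)); [split; lra|lra].
exists (X1 / r), (X2 / r); split.
- move=> x mx.
  have nux : msupport nu (r * x).
    move=> e e0; rewrite -dilate_ball//; apply: mx; exact: divr_gt0.
  have rxr : x = r * x / r by rewrite mulrAC divff ?mul1r// gt_eqF.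
  have [xX1|xX1] := eqVneq (r * x) X1; first by right; left; rewrite /= rxr xX1.
  have [xX2|xX2] := eqVneq (r * x) X2; first by right; right; rewrite /= rxr xX2.
  left; have /andP[x1 x2] := supp _ nux xX1 xX2.
  by rewrite /= in_itv/=; rewrite -dr in x1 x2; apply/andP; split; nra.
- by apply: dist; rewrite ler_norml; apply/andP; split; lra.
- by apply: dist; rewrite ler_norml; apply/andP; split; lra.
- rewrite /mun !dilate_set1// dilate_itv//; split => //.
  set m := fine _.
  have : m + p + q <= 1.
    rewrite /m /p /q -!fineU//.
    + by apply: fine_le1; do 2 apply: measurableU => //.
    + exact: measurableU.
    + apply/seteqP; split => // x [[|]] /=.
        by rewrite in_itv/= => /andP[_ xK] xX; move: xK; rewrite xX; lra.
      by move=> -> H; move: X12; rewrite H ltxx.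
    + by apply/seteqP; split => // x [] /=; rewrite in_itv/= => /andP[xK _] xX; move: xK; rewrite xX; lra.
  (* For d <= 1 / 4 the sharper mass bounds give at most 4 d / 5 for the middle part, making the
     inequality strict; for d > 1 / 4 already 1 < 4 d. *)
  case: (leP d (1 / 4)) => d4 mpq.
    by have := p_lo' d4; have := q_lo' d4; rewrite -/p -/q; lra.
  have : m <= 1 by exact: fine_le1.
  lra.
Qed.
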